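(* Let $\beta,\psi_0$ be real constants, $\kappa>0$, $K\neq0$, and $I=\{r>0: r>4K\}$. Set $\tilde{\mathcal{C}}\equiv0$, $\mathcal{V}\equiv0$, $\mathcal{A}(\psi)=\frac{3\beta}{8}\psi^2$, $C(r)=1$, $$A(r)=2-\frac{r}{2K}+\frac{\sqrt{r(r-4K)}}{2K},\qquad \psi(r)=\frac{\psi_0\big(\sqrt{r(r-4K)}-4K+r\big)\big(\sqrt{r(r-4K)}-2K+r\big)^{1/4}}{3K\,r^{3/4}\sqrt{r-4K}} .$$ Then $E^{(1)}_{tt}=E^{(1)}_{rr}=E^{(1)}_{\vartheta\vartheta}=E^{(1)}_{\psi}=0$ hold on $I$. (The metric ${\rm d}s^2=A^2{\rm d}t^2-A^{-2}{\rm d}r^2-r^2{\rm d}\Omega^2$ is asymptotically flat, with $A(r)\to1$ as $r\to\infty$, and for $K>0$ has a horizon $A(4K)=0$.)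
   Context: Metric ansatz ${\rm d}s^2=A(r)^2{\rm d}t^2-\frac{C(r)^2}{A(r)^2}{\rm d}r^2-r^2{\rm d}\Omega^2$, $\psi=\psi(r)$. Primes on $A,C,\psi$ are $r$-derivatives; $\mathcal{A}',\tilde{\mathcal{C}}',\tilde{\mathcal{C}}'',\mathcal{V}'$ are $\psi$-derivatives evaluated at $\psi(r)$. The real-tetrad reduced vacuum field equations of the scalar-torsion theory are: $E^{(1)}_{tt}:\ 0=\mathcal{A}\frac{A^2(-2rACA'-A^2(C-2rC')+C^3)}{r^2C^3}+\tilde{\mathcal{C}}'\Big(\frac{A^4\psi''}{C^2}-\frac{A^3\psi'(-rCA'+rAC'-2C^2)}{rC^3}\Big)-\frac{2A^3(A-C)\psi'\mathcal{A}'}{rC^2}+\frac{A^4\psi'^2\tilde{\mathcal{C}}''}{C^2}-\frac{\beta A^4\psi'^2}{2C^2}+\kappa^2A^2\mathcal{V}$; $E^{(1)}_{rr}:\ 0=-\frac{(2rAA'+A^2-C^2)\mathcal{A}}{r^2A^2}+\big(\frac{A'}{A}+\frac2r\big)\psi'\tilde{\mathcal{C}}'+\frac{\kappa^2C^2\mathcal{V}}{A^2}+\frac12\beta\psi'^2$; $E^{(1)}_{\vartheta\vartheta}:\ 0=-\frac{A\psi'(rA'+A-C)\mathcal{A}'}{rC^2}+\tilde{\mathcal{C}}'\Big(\frac{A\psi'(rCA'-rAC'+C^2)}{rC^3}+\frac{A^2\psi''}{C^2}\Big)+\frac{\mathcal{A}(-rCA'^2+A(rA'C'-C(rA''+2A'))+A^2C')}{rC^3}+\frac{A^2\psi'^2\tilde{\mathcal{C}}''}{C^2}-\frac{\beta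 A^2\psi'^2}{2C^2}+\kappa^2\mathcal{V}$; $E^{(1)}_{\psi}:\ 0=\frac{(A-C)(2rA'+A-C)\mathcal{A}'}{r^2C^2}+\frac{\beta A\psi'(2rCA'+A(2C-rC'))}{rC^3}+\frac{\beta A^2\psi''}{C^2}+\kappa^2\mathcal{V}'+\frac{\tilde{\mathcal{C}}'(rCA'(rA'-2C)+A(-r^2A'C'+rC(rA''+6A')-2C^2)+2A^2(C-rC'))}{r^2C^3}$. *)

(* Defs.v *)
From Stdlib Require Import Reals.
From Coquelicot Require Import Coquelicot.
Open Scope R_scope.

(* Reduced vacuum field equations of the scalar-torsion theory (real tetrad).
   A C psi : R -> R are the metric functions and scalar field (functions of r);
   cA cCt cV : R -> R are the theory functions calA, tilde C, V (functions of psi);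
   primes on A, C, psi are r-derivatives, primes on cA, cCt, cV are
   psi-derivatives evaluated at psi(r).  Each definition is the right-hand side
   of "0 = ..." at radius r. *)
Section FieldEqs.
Variables (beta kappa : R) (cA cCt cV A C psi : R -> R) (r : R).

Let a   := A r.
Let a1  := Derive A r.
Let a2  := Derive (Derive A) r.
Let c   := C r.
Let c1  := Derive C r.
Let p1  := Derive psi r.
Let p2  := Derive (Derive psi) r.
Let cA0 := cA (psi r).
Let cA1 := Derive cA (psi r).
Let Ct1 := Derive cCt (psi r).
Let Ct2 := Derive (Derive cCt) (psi r).
Let V0  := cV (psi r).
Let V1  := Derive cV (psi r).

Definition E_tt : R :=
  cA0 * (a^2 * (-2 * r * a * c * a1 - a^2 * (c - 2 * r * c1) + c^3) / (r^2 * c^3))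
  + Ct1 * (a^4 * p2 / c^2 - a^3 * p1 * (- r * c * a1 + r * a * c1 - 2 * c^2) / (r * c^3))
  - 2 * a^3 * (a - c) * p1 * cA1 / (r * c^2)
  + a^4 * p1^2 * Ct2 / c^2
  - beta * a^4 * p1^2 / (2 * c^2)
  + kappa^2 * a^2 * V0.

Definition E_rr : R :=
  - (2 * r * a * a1 + a^2 - c^2) * cA0 / (r^2 * a^2)
  + (a1 / a + 2 / r) * p1 * Ct1
  + kappa^2 * c^2 * V0 / a^2
  + 1/2 * beta * p1^2.

Definition E_thth : R :=
  - a * p1 * (r * a1 + a - c) * cA1 / (r * c^2)
  + Ct1 * (a * p1 * (r * c * a1 - r * a * c1 + c^2) / (r * c^3) + a^2 * p2 / c^2)
  + cA0 * (- r * c * a1^2 + a * (r * a1 * c1 - c * (r * a2 + 2 * a1)) + a^2 * c1)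
      / (r * c^3)
  + a^2 * p1^2 * Ct2 / c^2
  - beta * a^2 * p1^2 / (2 * c^2)
  + kappa^2 * V0.

Definition E_psi : R :=
  (a - c) * (2 * r * a1 + a - c) * cA1 / (r^2 * c^2)
  + beta * a * p1 * (2 * r * c * a1 + a * (2 * c - r * c1)) / (r * c^3)
  + beta * a^2 * p2 / c^2
  + kappa^2 * V1
  + Ct1 * (r * c * a1 * (r * a1 - 2 * c)
           + a * (- r^2 * a1 * c1 + r * c * (r * a2 + 6 * a1) - 2 * c^2)
           + 2 * a^2 * (c - r * c1)) / (r^2 * c^3).

End FieldEqs.

Definition solA (K r : R) : R :=
  2 - r / (2 * K) + sqrt (r * (r - 4 * K)) / (2 * K).

Definition solpsi (K psi0 r : R) : R :=
  psi0 * (sqrt (r * (r - 4 * K)) - 4 * K + r)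
       * Rpower (sqrt (r * (r - 4 * K)) - 2 * K + r) (1/4)
  / (3 * K * Rpower r (3/4) * sqrt (r - 4 * K)).

(* Main.v *)
Require Import Defs.
From Stdlib Require Import Reals Lra.
From Coquelicot Require Import Coquelicot.
Open Scope R_scope.

(* Put w := sqrt (1 - 4K/r).  Then sqrt (r (r - 4K)) = r w and 4K = r (1 - w^2), so on
   the exterior region A = 2w/(1+w) and psi = c (1+w)^(3/2) with c = psi0 2^(-1/4) / (3K).
   Since w' = (1 - w^2) / (2 r w), all r-derivatives of A and psi are rational in r, w
   and sqrt (1+w).  With tilde C = V = 0 and C = 1, substituting w = S^2 - 1 for
   S = sqrt (1+w) turns each field equation into a rational identity in r and S. *)

Lemma Derive_open_ext (U : R -> Prop) (f g : R -> R) (r l : R) :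
  open U -> (forall y, U y -> f y = g y) -> U r -> is_derive g r l -> Derive f r = l.
Proof.
  intros hU hfg hr hg.
  rewrite (Derive_ext_loc f g); [exact (is_derive_unique _ _ _ hg) |].
  exact (filter_imp U _ hfg (hU r hr)).
Qed.

Lemma Derive_scal_sqr (a p : R) : Derive (fun x => a * x ^ 2) p = 2 * a * p.
Proof. apply is_derive_unique. auto_derive; [easy | ring]. Qed.

Lemma Derive2_const (k x : R) : Derive (Derive (fun _ => k)) x = 0.
Proof. rewrite (Derive_ext _ (fun _ => 0)); apply Derive_const. Qed.

Lemma Rpower_quarter_mul_sqr (x y : R) :
  0 < x -> 0 < y -> Rpower (x * y ^ 2) (1/4) = Rpower x (1/4) * sqrt y.
Proof.
  intros hx hy.
  rewrite <- Rpower_mult_distr, <- (Rpower_pow 2 y), Rpower_mult, <- Rpower_sqrt;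
    try apply pow_lt; auto.
  do 2 f_equal; simpl; field.
Qed.

Lemma Rpower_three_quarters (r : R) :
  0 < r -> Rpower r (3/4) = r * Rpower r (1/4) / sqrt r.
Proof.
  intros hr.
  assert (0 < sqrt r) by now apply sqrt_lt_R0.
  assert (Rpower r (3/4) * sqrt r = r * Rpower r (1/4)) as <-; [|field; lra].
  rewrite <- (Rpower_1 r) at 3 by easy.
  rewrite <- Rpower_sqrt, <- !Rpower_plus by easy.
  f_equal; field.
Qed.

Ltac nonzero := repeat (apply Rmult_integral_contrapositive_currified || split); lra.

(* Given [0 < x], replace [x] by [S ^ 2 - 1] with [S = sqrt (1 + x)], so that [field]
   only sees rational functions of [S]. *)
Ltac rationalize_sqrt_one_add x :=
  assert (sqrt (1 + x) ^ 2 = 1 + x) by (rewrite <- Rsqr_pow2; apply Rsqr_sqrt; lra);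
  assert (0 < sqrt (1 + x)) by (apply sqrt_lt_R0; lra);
  let S := fresh "S" in set (S := sqrt (1 + x)) in *; clearbody S;
  let y := fresh "x" in set (y := x) in *; clearbody y;
  assert (y = S ^ 2 - 1) by lra; subst y.

Section Exterior.
Variable K : R.

Definition exterior (r : R) : Prop := 0 < r /\ 4 * K < r.

Definition w (r : R) : R := sqrt (1 - 4 * K / r).

Lemma exterior_open : open exterior.
Proof. apply open_and; apply open_gt. Qed.

Lemma exterior_radicand_pos (r : R) : exterior r -> 0 < 1 - 4 * K / r.
Proof.
  intros [hr hrK].
  enough (4 * K / r < 1) by lra.
  apply (Rmult_lt_reg_r r); [easy |].
  field_simplify; lra.
Qed.

Lemma w_pos (r : R) : exterior r -> 0 < w r.
Proof. intros hr. now apply sqrt_lt_R0, exterior_radicand_pos. Qed.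

Lemma four_K_eq (r : R) : exterior r -> 4 * K = r * (1 - w r ^ 2).
Proof.
  intros hr. pose proof (exterior_radicand_pos r hr).
  unfold w. rewrite <- Rsqr_pow2, Rsqr_sqrt by lra.
  destruct hr. field. lra.
Qed.

Lemma sqrt_r_mul_r_sub (r : R) : exterior r -> sqrt (r * (r - 4 * K)) = r * w r.
Proof.
  intros hr. pose proof (w_pos r hr).
  rewrite (four_K_eq r hr), <- (sqrt_pow2 (r * w r)) by (destruct hr; nra).
  f_equal. ring.
Qed.

Lemma sqrt_r_sub (r : R) : exterior r -> sqrt (r - 4 * K) = sqrt r * w r.
Proof.
  intros hr. pose proof (w_pos r hr). pose proof (four_K_eq r hr). destruct hr.
  rewrite <- (sqrt_pow2 (w r)), <- sqrt_mult by nra.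
  f_equal. lra.
Qed.

Definition dA (r x : R) : R := (1 - x) / (r * x * (1 + x)).
Definition ddA (r x : R) : R := - (1 - x ^ 2) / (2 * r ^ 2 * x ^ 3).
Definition dpsi (c r x : R) : R := 3 * c * (1 - x ^ 2) * sqrt (1 + x) / (4 * r * x).
Definition ddpsi (c r x : R) : R :=
  - 3 * c * (1 - x ^ 2) * (7 * x ^ 2 - x + 2) * sqrt (1 + x) / (16 * r ^ 2 * x ^ 3).

Ltac derive_in_w hr :=
  let r := match type of hr with exterior ?r => r end in
  pose proof (exterior_radicand_pos r hr); pose proof (w_pos r hr);
  pose proof (four_K_eq r hr) as h4K; pose proof hr as [hr0 _];
  unfold dA, ddA, dpsi, ddpsi, w; auto_derive;
  change (1 + - (4 * K * / r)) with (1 - 4 * K / r) in *; fold (w r) in *;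
  [nonzero | rewrite ?h4K; rationalize_sqrt_one_add (w r); field; nonzero].

Lemma is_derive_A (r : R) :
  exterior r -> is_derive (fun y => 2 * w y / (1 + w y)) r (dA r (w r)).
Proof. intros hr. derive_in_w hr. Qed.

Lemma is_derive_dA (r : R) :
  exterior r -> is_derive (fun y => dA y (w y)) r (ddA r (w r)).
Proof. intros hr. derive_in_w hr. Qed.

Lemma is_derive_psi (c r : R) : exterior r ->
  is_derive (fun y => c * (1 + w y) * sqrt (1 + w y)) r (dpsi c r (w r)).
Proof. intros hr. derive_in_w hr. Qed.

Lemma is_derive_dpsi (c r : R) :
  exterior r -> is_derive (fun y => dpsi c y (w y)) r (ddpsi c r (w r)).
Proof. intros hr. derive_in_w hr. Qed.

Hypothesis K_neq0 : K <> 0.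

Lemma one_sub_w_sqr_neq0 (r : R) : exterior r -> 1 - w r ^ 2 <> 0.
Proof.
  intros hr h. apply K_neq0.
  enough (4 * K = 0) by lra.
  now rewrite (four_K_eq r hr), h, Rmult_0_r.
Qed.

Lemma solA_eq (r : R) : exterior r -> solA K r = 2 * w r / (1 + w r).
Proof.
  intros hr. pose proof (w_pos r hr). pose proof (one_sub_w_sqr_neq0 r hr).
  unfold solA. rewrite sqrt_r_mul_r_sub by easy.
  replace (2 * K) with (r * (1 - w r ^ 2) / 2) by (rewrite <- (four_K_eq r hr); field).
  destruct hr. field. repeat split; lra.
Qed.

Definition psi_coef (psi0 : R) : R := psi0 / (3 * K) * Rpower (/ 2) (1/4).

Lemma solpsi_eq (psi0 r : R) : exterior r ->
  solpsi K psi0 r = psi_coef psi0 * (1 + w r) * sqrt (1 + w r).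
Proof.
  intros hr. pose proof (w_pos r hr). pose proof (four_K_eq r hr) as h4K.
  unfold solpsi, psi_coef. rewrite sqrt_r_mul_r_sub, sqrt_r_sub by easy.
  destruct hr as [hr0 _].
  replace (r * w r - 4 * K + r) with (r * w r * (1 + w r)) by (rewrite h4K; ring).
  replace (r * w r - 2 * K + r) with (r * / 2 * (1 + w r) ^ 2) by lra.
  rewrite Rpower_quarter_mul_sqr, <- Rpower_mult_distr, Rpower_three_quarters by lra.
  assert (0 < sqrt r) by now apply sqrt_lt_R0.
  assert (0 < Rpower r (1/4)) by apply exp_pos.
  field. repeat split; lra.
Qed.

Lemma Derive_solA (r : R) : exterior r -> Derive (solA K) r = dA r (w r).
Proof.
  intros hr. apply (Derive_open_ext exterior _ (fun y => 2 * w y / (1 + w y)));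
    auto using exterior_open, solA_eq, is_derive_A.
Qed.

Lemma Derive2_solA (r : R) : exterior r -> Derive (Derive (solA K)) r = ddA r (w r).
Proof.
  intros hr. apply (Derive_open_ext exterior _ (fun y => dA y (w y)));
    auto using exterior_open, Derive_solA, is_derive_dA.
Qed.

Lemma Derive_solpsi (psi0 r : R) : exterior r ->
  Derive (solpsi K psi0) r = dpsi (psi_coef psi0) r (w r).
Proof.
  intros hr.
  apply (Derive_open_ext exterior _ (fun y => psi_coef psi0 * (1 + w y) * sqrt (1 + w y)));
    auto using exterior_open, solpsi_eq, is_derive_psi.
Qed.

Lemma Derive2_solpsi (psi0 r : R) : exterior r ->
  Derive (Derive (solpsi K psi0)) r = ddpsi (psi_coef psi0) r (w r).
Proof.
  intros hr. apply (Derive_open_ext exterior _ (fun y => dpsi (psi_coef psi0) y (w y)));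
    auto using exterior_open, Derive_solpsi, is_derive_dpsi.
Qed.

End Exterior.

Theorem mainTheorem6 (beta psi0 kappa K : R) (hkappa : 0 < kappa) (hK : K <> 0) :
  forall r : R, 0 < r -> 4 * K < r ->
    let cA  := fun p : R => 3 * beta / 8 * p^2 in
    let cCt := fun _ : R => 0 in
    let cV  := fun _ : R => 0 in
    let C   := fun _ : R => 1 in
    let A   := solA K in
    let psi := solpsi K psi0 in
    E_tt   beta kappa cA cCt cV A C psi r = 0 /\
    E_rr   beta kappa cA cCt cV A C psi r = 0 /\
    E_thth beta kappa cA cCt cV A C psi r = 0 /\
    E_psi  beta kappa cA cCt cV A C psi r = 0.
Proof.
  intros r hr0 hrK cA cCt cV C A psi.
  assert (hr : exterior K r) by easy.
  unfold E_tt, E_rr, E_thth, E_psi, cA, cCt, cV, C, A, psi.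
  rewrite !Derive_scal_sqr, !Derive2_const, !Derive_const, Derive2_solA, Derive_solA,
    Derive2_solpsi, Derive_solpsi, solA_eq, solpsi_eq by easy.
  pose proof (w_pos K r hr).
  unfold dA, ddA, dpsi, ddpsi.
  rationalize_sqrt_one_add (w K r).
  repeat split; field; nonzero.
Qed.
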